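(* Let $\mathscr{A}$ be an abelian category, let $\mathscr{E}$ be a subcategory of $\mathscr{A}$, and let $\mathscr{T}$ be an $\mathscr{E}$-preresolving subcategory of $\mathscr{A}$ admitting an $\mathscr{E}$-proper generator $\mathscr{C}$. The following statements are equivalent for any object $A$ in $\mathscr{A}$ and any $n\geq 0$: (1) $\mathscr{T}\text{-}\dim A\leq n$. (2) There exists an exact sequence $$0\to K_n\to C_{n-1}\to C_{n-2}\to\cdots\to C_0\to A\to 0$$ in $\mathscr{A}$ with all $C_i$ objects in $\mathscr{C}$ and $K_n$ an object in $\mathscr{T}$.
   Context: All subcategories of $\mathscr{A}$ are full and additive. A sequence $\mathbb{S}$ in $\mathscr{A}$ is $\operatorname{Hom}_{\mathscr{A}}(\mathscr{E},-)$-exact if $\operatorname{Hom}_{\mathscr{A}}(E,\mathbb{S})$ is exact for every object $E$ in $\mathscr{E}$. For subcategories $\mathscr{C}\subseteq\mathscr{T}$ of $\mathscr{A}$, $\mathscr{C}$ is an $\mathscr{E}$-proper generator for $\mathscr{T}$ if for any object $T$ in $\mathscr{T}$ there exists a $\operatorname{Hom}_{\mathscr{A}}(\mathscr{E},-)$-exact exact sequence $0\to T'\to C\to T\to 0$ in $\mathscr{A}$ with $C$ an object in $\mathscr{C}$ and $T'$ an object in $\mathscr{T}$. $\mathscr{T}$ is $\mathscr{E}$-preresolving if (i) $\mathscr{T}$ admits an $\mathscr{E}$-proper generator, and (ii) $\mathscr{T}$ is closed under $\mathscr{E}$-proper extensions: for any $\operatorname{Hom}_{\mathscr{A}}(\mathscr{E},-)$-exact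 exact sequence $0\to A_1\to A_2\to A_3\to 0$ in $\mathscr{A}$ with $A_1,A_3$ in $\mathscr{T}$, also $A_2$ is in $\mathscr{T}$. $\mathscr{T}\text{-}\dim A$ is the infimum of the integers $n\geq 0$ for which there exists an exact sequence $0\to T_n\to\cdots\to T_1\to T_0\to A\to 0$ in $\mathscr{A}$ with all $T_i$ objects in $\mathscr{T}$, and it is $\infty$ if no such $n$ exists. For $n=0$, the sequence in (2) reads $0\to K_0\to A\to 0$. *)

(* Defs.v *)
From HB Require Import structures.
From mathcomp Require Import all_boot all_algebra.
From mathcomp Require Import boolp.

Set Implicit Arguments.
Unset Strict Implicit.
Unset Printing Implicit Defensive.

Import GRing.Theory.
Local Open Scope ring_scope.

(* [compm g f] is the composite "g after f". *)
Record preadditiveCategory := PreadditiveCategory {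
  Ob :> Type;
  mor : Ob -> Ob -> zmodType;
  idm : forall X, mor X X;
  compm : forall X Y Z, mor Y Z -> mor X Y -> mor X Z;
  comp1m : forall X Y (f : mor X Y), compm (idm Y) f = f;
  compm1 : forall X Y (f : mor X Y), compm f (idm X) = f;
  compmA : forall X Y Z W (h : mor Z W) (g : mor Y Z) (f : mor X Y),
    compm h (compm g f) = compm (compm h g) f;
  compmDl : forall X Y Z (g g' : mor Y Z) (f : mor X Y),
    compm (g + g') f = compm g f + compm g' f;
  compmDr : forall X Y Z (g : mor Y Z) (f f' : mor X Y),
    compm g (f + f') = compm g f + compm g f'
}.

Arguments mor {p} _ _.
Arguments idm {p} X.
Arguments compm {p X Y Z} _ _.

Notation "g ∘ f" := (compm g f) (at level 40, left associativity) : ring_scope.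

Section Preadditive.
Variable A : preadditiveCategory.
Implicit Types X Y Z W : A.

(* Hom-groups are nonempty, so uniqueness of the maps is all that is left to
   say that Z is initial and terminal. *)
Definition is_zero Z : Prop :=
  (forall X (f : mor X Z), f = 0) /\ (forall X (f : mor Z X), f = 0).

Definition is_biproduct X Y P
    (i1 : mor X P) (i2 : mor Y P) (p1 : mor P X) (p2 : mor P Y) : Prop :=
  [/\ p1 ∘ i1 = idm X, p2 ∘ i2 = idm Y, p1 ∘ i2 = 0, p2 ∘ i1 = 0
    & i1 ∘ p1 + i2 ∘ p2 = idm P].

Definition biproduct_of X Y P : Prop :=
  exists (i1 : mor X P) (i2 : mor Y P) (p1 : mor P X) (p2 : mor P Y),
    is_biproduct i1 i2 p1 p2.

Definition monomorphism X Y (f : mor X Y) : Prop :=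
  forall W (u v : mor W X), f ∘ u = f ∘ v -> u = v.

Definition epimorphism X Y (f : mor X Y) : Prop :=
  forall W (u v : mor Y W), u ∘ f = v ∘ f -> u = v.

Definition is_kernel X Y K (f : mor X Y) (k : mor K X) : Prop :=
  f ∘ k = 0 /\
  forall W (h : mor W X), f ∘ h = 0 -> exists! u : mor W K, k ∘ u = h.

Definition is_cokernel X Y C (f : mor X Y) (c : mor Y C) : Prop :=
  c ∘ f = 0 /\
  forall W (h : mor Y W), h ∘ f = 0 -> exists! u : mor C W, u ∘ c = h.

(* Im f = Ker (Coker f) *)
Definition is_image X Y I (f : mor X Y) (m : mor I Y) : Prop :=
  exists (C : A) (c : mor Y C), is_cokernel f c /\ is_kernel c m.

(* X -f-> Y -g-> Z is exact at Y: Im f = Ker g as subobjects of Y. *)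
Definition exact_at X Y Z (f : mor X Y) (g : mor Y Z) : Prop :=
  exists (I : A) (m : mor I Y), is_image f m /\ is_kernel g m.

(* Exactness at Hom(E, Y), as abelian groups, of
   Hom(E, X) -> Hom(E, Y) -> Hom(E, Z). *)
Definition hom_exact_at (E : A) X Y Z (f : mor X Y) (g : mor Y Z) : Prop :=
  forall y : mor E Y, g ∘ y = 0 <-> exists x : mor E X, f ∘ x = y.

End Preadditive.

Record abelianCategory := AbelianCategory {
  abelian_base :> preadditiveCategory;
  zob : abelian_base;
  zobP : is_zero zob;
  biproductP : forall X Y : abelian_base,
    exists P : abelian_base, biproduct_of X Y P;
  kernelP : forall (X Y : abelian_base) (f : mor X Y),
    exists (K : abelian_base) (k : mor K X), is_kernel f k;
  cokernelP : forall (X Y : abelian_base) (f : mor X Y),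
    exists (C : abelian_base) (c : mor Y C), is_cokernel f c;
  mono_normal : forall (X Y : abelian_base) (f : mor X Y), monomorphism f ->
    exists (Z : abelian_base) (g : mor Y Z), is_kernel g f;
  epi_normal : forall (X Y : abelian_base) (f : mor X Y), epimorphism f ->
    exists (W : abelian_base) (g : mor W X), is_cokernel g f
}.

Arguments zob {a}.

(* A full additive subcategory, given by its objects.  It is not assumed to be
   closed under isomorphisms. *)
Record subcategory (A : abelianCategory) := Subcategory {
  sub_obj :> A -> Prop;
  sub_zero : exists2 Z, sub_obj Z & is_zero Z;
  sub_biproduct : forall X Y, sub_obj X -> sub_obj Y ->
    exists2 P, sub_obj P & biproduct_of X Y P
}.

Section Abelian.
Variable A : abelianCategory.
Implicit Types (E T C : subcategory A) (X : A).

(* 0 -> A1 -f-> A2 -g-> A3 -> 0 *)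
Definition short_exact (A1 A2 A3 : A) (f : mor A1 A2) (g : mor A2 A3) : Prop :=
  [/\ exact_at (0 : mor zob A1) f, exact_at f g & exact_at g (0 : mor A3 zob)].

Definition hom_short_exact E (A1 A2 A3 : A) (f : mor A1 A2) (g : mor A2 A3) :
    Prop :=
  forall e : A, E e ->
    [/\ hom_exact_at e (0 : mor zob A1) f, hom_exact_at e f g
      & hom_exact_at e g (0 : mor A3 zob)].

Definition proper_generator E C T : Prop :=
  (forall X, C X -> T X) /\
  forall X, T X -> exists (T' C' : A) (f : mor T' C') (g : mor C' X),
    [/\ T T', C C', short_exact f g & hom_short_exact E f g].

Definition closed_proper_extensions E T : Prop :=
  forall (A1 A2 A3 : A) (f : mor A1 A2) (g : mor A2 A3),
    short_exact f g -> hom_short_exact E f g -> T A1 -> T A3 -> T A2.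

Definition preresolving E T : Prop :=
  (exists C, proper_generator E C T) /\ closed_proper_extensions E T.

(* An exact sequence 0 -> X_n -> ... -> X_1 -> X_0 -> X -> 0.  The leftmost 0 is
   X_(n+1); the objects X_i and maps d_i with larger i are irrelevant. *)
Record resolution (n : nat) X := Resolution {
  res_ob :> nat -> A;
  res_d : forall i, mor (res_ob i.+1) (res_ob i);
  res_aug : mor (res_ob 0) X;
  res_left0 : is_zero (res_ob n.+1);
  res_exact : forall i, (i < n)%N -> exact_at (res_d i.+1) (res_d i);
  res_exact0 : exact_at (res_d 0) res_aug;
  res_exact_aug : exact_at res_aug (0 : mor X zob)
}.

Definition has_resolution T X (n : nat) : Prop :=
  exists r : resolution n X, forall i, (i <= n)%N -> T (r i).

(* The T-dimension, in nat extended by [None] = infinity. *)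
Definition rel_dim T X : option nat :=
  if pselect (exists n, `[< has_resolution T X n >]) is left h
  then Some (ex_minn h) else None.

End Abelian.

Definition dim_le (d : option nat) (n : nat) : bool :=
  if d is Some m then (m <= n)%N else false.

(* Main.v *)
Require Import Defs.
From mathcomp Require Import all_boot.
From mathcomp Require Import all_algebra boolp.

(** Given a [T]-resolution [... -> T1 -> T0 -> X -> 0], choose a proper exact
    sequence [0 -> T' -> C0 -> T0 -> 0] and pull it back, first along
    [K := Ker (T0 -> X) -> T0] and then along [T1 -> K].  The first pullback [L]
    is the kernel of [C0 -> X]; the second one, [M], is a proper extension of
    [T1] by [T'], so it lies in [T], and [... -> T2 -> M -> L -> 0] is exact.
    Thus [L] has a [T]-resolution one step shorter, and induction applies.
    Exactness is tested on generalized elements: a morphism killed by the second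
    map lifts through the first one after precomposition with an epimorphism. *)

Set Implicit Arguments.
Unset Strict Implicit.
Unset Printing Implicit Defensive.

Section AbelianCategories.
Import GRing.Theory.
Local Open Scope ring_scope.

(** * Monomorphisms, kernels and pullbacks in a preadditive category *)

Section Preadditive.
Variable A : preadditiveCategory.
Implicit Types X Y Z W : A.

Lemma comp0m X Y Z (f : mor X Y) : (0 : mor Y Z) ∘ f = 0.
Proof. by apply: (addrI ((0 : mor Y Z) ∘ f)); rewrite -compmDl !addr0. Qed.

Lemma compm0 X Y Z (g : mor Y Z) : g ∘ (0 : mor X Y) = 0.
Proof. by apply: (addrI (g ∘ (0 : mor X Y))); rewrite -compmDr !addr0. Qed.

Lemma compmNl X Y Z (g : mor Y Z) (f : mor X Y) : (- g) ∘ f = - (g ∘ f).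
Proof. by apply: (addrI (g ∘ f)); rewrite -compmDl !subrr comp0m. Qed.

Lemma compmNr X Y Z (g : mor Y Z) (f : mor X Y) : g ∘ (- f) = - (g ∘ f).
Proof. by apply: (addrI (g ∘ f)); rewrite -compmDr !subrr compm0. Qed.

Lemma monomorphism0 X Y (f : mor X Y) :
  (forall W (u : mor W X), f ∘ u = 0 -> u = 0) -> monomorphism f.
Proof.
move=> f0 W u v fuv; apply/eqP; rewrite -subr_eq0; apply/eqP/f0.
by rewrite compmDr compmNr fuv subrr.
Qed.

Lemma epimorphism0 X Y (f : mor X Y) :
  (forall W (u : mor Y W), u ∘ f = 0 -> u = 0) -> epimorphism f.
Proof.
move=> f0 W u v fuv; apply/eqP; rewrite -subr_eq0; apply/eqP/f0.
by rewrite compmDl compmNl fuv subrr.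
Qed.

Lemma mono_eq0 X Y W (f : mor X Y) (u : mor W X) :
  monomorphism f -> f ∘ u = 0 -> u = 0.
Proof. by move=> mf fu; apply: mf; rewrite fu compm0. Qed.

Lemma epi_eq0 X Y W (f : mor X Y) (u : mor Y W) :
  epimorphism f -> u ∘ f = 0 -> u = 0.
Proof. by move=> ef uf; apply: ef; rewrite uf comp0m. Qed.

Lemma epi_id X : epimorphism (idm X).
Proof. by move=> W u v; rewrite !compm1. Qed.

Lemma epi_cancel X Y Z (g : mor Y Z) (f : mor X Y) :
  epimorphism (g ∘ f) -> epimorphism g.
Proof. by move=> egf W u v ugvg; apply: egf; rewrite !compmA ugvg. Qed.

Lemma epi_comp X Y Z (g : mor Y Z) (f : mor X Y) :
  epimorphism g -> epimorphism f -> epimorphism (g ∘ f).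
Proof. by move=> eg ef W u v; rewrite !compmA => /ef/eg. Qed.

Lemma mono_comp X Y Z (g : mor Y Z) (f : mor X Y) :
  monomorphism g -> monomorphism f -> monomorphism (g ∘ f).
Proof. by move=> mg mf W u v; rewrite -!compmA => /mg/mf. Qed.

Lemma kernel_mono X Y K (f : mor X Y) (k : mor K X) :
  is_kernel f k -> monomorphism k.
Proof.
move=> [fk kP] W u v kuv.
have [|w [_ wP]] := kP W (k ∘ u); first by rewrite compmA fk comp0m.
by rewrite -(wP u) // -(wP v).
Qed.

Lemma kernel_lift X Y K W (f : mor X Y) (k : mor K X) (h : mor W X) :
  is_kernel f k -> f ∘ h = 0 -> exists u : mor W K, k ∘ u = h.
Proof. by move=> [_ kP] /kP[u [ku _]]; exists u. Qed.

Lemma cokernel_desc X Y C W (f : mor X Y) (c : mor Y C) (h : mor Y W) :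
  is_cokernel f c -> h ∘ f = 0 -> exists u : mor C W, u ∘ c = h.
Proof. by move=> [_ cP] /cP[u [uc _]]; exists u. Qed.

Lemma mono_kernel X Y K (f : mor X Y) (k : mor K X) :
  monomorphism k -> f ∘ k = 0 ->
  (forall W (h : mor W X), f ∘ h = 0 -> exists u : mor W K, k ∘ u = h) ->
  is_kernel f k.
Proof.
move=> mk fk kP; split=> // W h /kP[u ku].
by exists u; split=> // v kv; apply: mk; rewrite ku kv.
Qed.

(** Unique factorization is split into existence and joint monicity of [p] and [q]; the latter is
    what compares two morphisms into [P]. *)
Definition is_pullback X Y Z P (f : mor X Z) (g : mor Y Z)
    (p : mor P X) (q : mor P Y) : Prop :=
  [/\ f ∘ p = g ∘ q,
      forall W (u : mor W X) (v : mor W Y), f ∘ u = g ∘ v ->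
        exists w : mor W P, p ∘ w = u /\ q ∘ w = v
    & forall W (w w' : mor W P), p ∘ w = p ∘ w' -> q ∘ w = q ∘ w' -> w = w'].

Lemma pullback_sym X Y Z P (f : mor X Z) (g : mor Y Z)
    (p : mor P X) (q : mor P Y) :
  is_pullback f g p q -> is_pullback g f q p.
Proof.
move=> [fpgq ex un]; split=> [||W w w' qw pw]; [by [] | | exact: un].
by move=> W u v /esym/ex[w [pw qw]]; exists w.
Qed.

(** The pair [(k, 0)] is compatible with [f] and [g], and the map [j] it induces picks out exactly
    the elements of [P] with zero second component. *)
Lemma pullback_kernel X Y Z P K (f : mor X Z) (g : mor Y Z)
    (p : mor P X) (q : mor P Y) (k : mor K X) :
  is_pullback f g p q -> is_kernel f k ->
  exists j : mor K P, p ∘ j = k /\ is_kernel q j.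
Proof.
move=> [fpgq ex un] kerk; have mk := kernel_mono kerk.
have [|j [pj qj]] := ex K k 0; first by rewrite kerk.1 compm0.
exists j; split=> //; apply: mono_kernel => // [W u v juv|W h qh].
  by apply: mk; rewrite -pj -!compmA juv.
have [|u ku] := @kernel_lift _ _ _ _ _ _ (p ∘ h) kerk.
  by rewrite compmA fpgq -compmA qh compm0.
exists u; apply: un; first by rewrite compmA pj.
by rewrite compmA qj qh comp0m.
Qed.

End Preadditive.

(** * Pullbacks and exactness in an abelian category *)

Section Abelian.
Variable A : abelianCategory.
Implicit Types X Y Z W : A.

(** By normality [f] is the cokernel of some [g], and [g] factors through [k]. Hence whatever kills
    [k] kills [g] and descends along [f]. *)
Lemma epi_cokernel X Y K (f : mor X Y) (k : mor K X) :
  epimorphism f -> is_kernel f k -> is_cokernel k f.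
Proof.
move=> ef kerk; have [W [g cokg]] := epi_normal ef.
split=> [|V h hk]; first exact: kerk.1.
have [t kt] := kernel_lift kerk cokg.1.
have [|u uf] := @cokernel_desc _ _ _ _ _ _ _ h cokg.
  by rewrite -kt compmA hk comp0m.
by exists u; split=> // v vf; apply: ef; rewrite uf vf.
Qed.

Lemma pullback_exists X Y Z (f : mor X Z) (g : mor Y Z) :
  exists (P : A) (p : mor P X) (q : mor P Y), is_pullback f g p q.
Proof.
have [S [i1 [i2 [p1 [p2 [p1i1 p2i2 p1i2 p2i1 sumS]]]]]] := biproductP X Y.
(* The pullback is the kernel of the difference map on the biproduct. *)
have [K [k kerk]] := kernelP (f ∘ p1 - g ∘ p2).
have E W (h : mor W S) : (f ∘ p1 - g ∘ p2) ∘ h = f ∘ (p1 ∘ h) - g ∘ (p2 ∘ h).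
  by rewrite compmDl compmNl !compmA.
exists K, (p1 ∘ k), (p2 ∘ k); split=> [|W u v fugv|W w w'].
- by apply/eqP; rewrite -subr_eq0 -E kerk.1.
- have p1h : p1 ∘ (i1 ∘ u + i2 ∘ v) = u.
    by rewrite compmDr !compmA p1i1 p1i2 comp1m comp0m addr0.
  have p2h : p2 ∘ (i1 ∘ u + i2 ∘ v) = v.
    by rewrite compmDr !compmA p2i1 p2i2 comp1m comp0m add0r.
  have [|w kw] := @kernel_lift _ _ _ _ _ _ _ (i1 ∘ u + i2 ∘ v) kerk.
    by rewrite E p1h p2h fugv subrr.
  by exists w; rewrite -!compmA kw.
- rewrite -!compmA => e1 e2; apply: (kernel_mono kerk).
  by rewrite -(comp1m (k ∘ w)) -(comp1m (k ∘ w')) -sumS !compmDl -!compmA e1 e2.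
Qed.

(** The difference map [d] is epi, hence the cokernel of its kernel. If [u] kills [q], then [u ∘ p2]
    kills that kernel and so equals some [v ∘ d]; restricting to [X] gives [v ∘ f = 0], so [v] and
    then [u] vanish. *)
Lemma pullback_epi X Y Z P (f : mor X Z) (g : mor Y Z)
    (p : mor P X) (q : mor P Y) :
  is_pullback f g p q -> epimorphism f -> epimorphism q.
Proof.
move=> [fpgq ex _] ef.
have [S [i1 [i2 [p1 [p2 [p1i1 p2i2 p1i2 p2i1 sumS]]]]]] := biproductP X Y.
set d := f ∘ p1 - g ∘ p2.
have di1 : d ∘ i1 = f.
  by rewrite compmDl compmNl -!compmA p1i1 p2i1 compm1 compm0 subr0.
have ed : epimorphism d by apply: (@epi_cancel _ _ _ _ _ i1); rewrite di1.
have [K [k kerk]] := kernelP d.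
have [w [_ qw]] : exists w : mor K P, p ∘ w = p1 ∘ k /\ q ∘ w = p2 ∘ k.
  apply: ex; apply/eqP; rewrite -subr_eq0 !compmA -compmNl -compmDl.
  by rewrite kerk.1.
apply: epimorphism0 => W u uq.
have [|v vd] := @cokernel_desc _ _ _ _ _ _ _ (u ∘ p2) (epi_cokernel ed kerk).
  by rewrite -compmA -qw compmA uq comp0m.
have v0 : v = 0.
  by apply: (epi_eq0 ef); rewrite -di1 compmA vd -compmA p2i1 compm0.
by rewrite -(compm1 u) -p2i2 compmA -vd v0 !comp0m.
Qed.

(** If [u] kills [e], then [f] factors through the subobject [m ∘ k] with [k] the kernel of [u].
    This subobject is the kernel of some [g], which kills [f], factors through the cokernel [c] and
    so kills [m]. Thus [k] has a right inverse, and [u = 0]. *)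
Lemma image_epi X Y I (f : mor X Y) (m : mor I Y) :
  is_image f m -> exists2 e : mor X I, epimorphism e & m ∘ e = f.
Proof.
move=> [C [c [cokc kerm]]].
have mm := kernel_mono kerm.
have [e me] := kernel_lift kerm cokc.1; exists e => //.
apply: epimorphism0 => W u ue.
have [K [k kerk]] := kernelP u.
have [e' ke'] := kernel_lift kerk ue.
have [Z [g kerg]] := mono_normal (mono_comp mm (kernel_mono kerk)).
have gf : g ∘ f = 0.
  by rewrite -me -ke' (compmA m) compmA kerg.1 comp0m.
have [g' g'c] := cokernel_desc cokc gf.
have [|s mks] := @kernel_lift _ _ _ _ _ _ _ m kerg.
  by rewrite -g'c -compmA kerm.1 compm0.
have ks : k ∘ s = idm I by apply: mm; rewrite compmA mks compm1.
by rewrite -(compm1 u) -ks compmA kerk.1 comp0m.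
Qed.

Lemma exact_atP X Y Z (f : mor X Y) (g : mor Y Z) :
  exact_at f g <->
  g ∘ f = 0 /\
  forall W (h : mor W Y), g ∘ h = 0 ->
    exists (V : A) (p : mor V W) (u : mor V X), epimorphism p /\ f ∘ u = h ∘ p.
Proof.
split=> [[I [m [/image_epi[e ee <-] kerm]]]|[gf liftf]].
  split=> [|W h gh]; first by rewrite compmA kerm.1 comp0m.
  have [t <-] := kernel_lift kerm gh.
  (* The lift exists only after passing to the cover [p], the base change of the epi part [e] of
     [f]. *)
  have [P [u [p pb]]] := pullback_exists e t.
  exists P, p, u; split; first exact: pullback_epi pb ee.
  by case: pb => eutp _ _; rewrite -!compmA eutp.
have [K [m kerm]] := kernelP g; exists K, m; split=> //.
have [C [c cokc]] := cokernelP f; exists C, c; split=> //.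
(* The kernel of [g] is also that of [c]: [c] kills [m] because [m] lifts through [f] up to an
   epimorphism, and [g] factors through [c]. *)
apply: mono_kernel => [||W h ch]; first exact: kernel_mono kerm.
  have [V [p [u [ep fu]]]] := liftf _ _ kerm.1.
  by apply: (epi_eq0 ep); rewrite -compmA -fu compmA cokc.1 comp0m.
have [g' g'c] := cokernel_desc cokc gf.
by apply: (kernel_lift kerm); rewrite -g'c -compmA ch compm0.
Qed.

Lemma exact_epiP X Y (f : mor X Y) :
  exact_at f (0 : mor Y zob) <-> epimorphism f.
Proof.
split=> [/exact_atP[_ /(_ _ (idm Y))]|ef].
  rewrite comp0m => /(_ erefl)[V [p [u [ep fu]]]].
  by apply: (@epi_cancel _ _ _ _ _ u); rewrite fu comp1m.
apply/exact_atP; split=> [|W h _]; first exact: comp0m.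
have [P [u [p pb]]] := pullback_exists f h.
by exists P, p, u; split; [exact: pullback_epi pb ef | case: pb].
Qed.

(** An arbitrary zero object is allowed because the left end of a resolution need not be [zob]. *)
Lemma exact_monoP X Y Z (f : mor X Y) :
  is_zero Z -> exact_at (0 : mor Z X) f <-> monomorphism f.
Proof.
move=> Z0; split=> [/exact_atP[_ ex]|mf].
  apply: monomorphism0 => W u /ex[V [p [v [ep]]]].
  by rewrite comp0m => /esym/(epi_eq0 ep).
apply/exact_atP; split=> [|W h /(mono_eq0 mf) ->]; first exact: compm0.
by exists W, (idm W), 0; split; [exact: epi_id | rewrite !comp0m].
Qed.

Lemma short_exactP X Y Z (f : mor X Y) (g : mor Y Z) :
  short_exact f g <-> is_kernel g f /\ epimorphism g.
Proof.
have monoP := exact_monoP f (zobP A).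
split=> [[/monoP mf exfg /exact_epiP eg]|[kerf eg]].
  split=> //; case: exfg => I [m [/image_epi[e ee mef] kerm]].
  have gf : g ∘ f = 0 by rewrite -mef compmA kerm.1 comp0m.
  have me : monomorphism e.
    by move=> W u v euv; apply: mf; rewrite -mef -!compmA euv.
  (* The epi and mono [e] is the kernel of some [q], which must be 0; so the identity of [I] lifts
     to a right inverse [s] of [e]. *)
  have [W [q kere]] := mono_normal me.
  have q0 : q = 0 by apply: (epi_eq0 ee kere.1).
  have [|s es] := @kernel_lift _ _ _ _ _ _ _ (idm I) kere.
    by rewrite q0 comp0m.
  apply: mono_kernel => // V h /(kernel_lift kerm)[t mt].
  by exists (s ∘ t); rewrite -mef -compmA (compmA e) es comp1m.
split; [apply/monoP; exact: kernel_mono kerf | | exact/exact_epiP].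
apply/exact_atP; split=> [|W h /(kernel_lift kerf)[u fu]]; first exact: kerf.1.
by exists W, (idm W), u; split; [exact: epi_id | rewrite compm1].
Qed.

(** Hom functors are left exact, so only surjectivity on the right remains to be required. *)
Lemma hom_short_exactP (E : subcategory A) X Y Z (f : mor X Y) (g : mor Y Z) :
  is_kernel g f ->
  hom_short_exact E f g <->
  forall e : A, E e -> forall y : mor e Z, exists x : mor e Y, g ∘ x = y.
Proof.
move=> kerf; split=> [hom e Ee y|lift e Ee].
  by have [_ _ /(_ y)[+ _]] := hom e Ee; apply; rewrite comp0m.
split=> y; split=> [|[x <-]].
- by move=> /(mono_eq0 (kernel_mono kerf)) ->; exists 0; rewrite compm0.
- by rewrite comp0m compm0.
- exact: kernel_lift.
- by rewrite compmA kerf.1 comp0m.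
- by move=> _; apply: lift.
- by rewrite comp0m.
Qed.

Lemma pullback_proper (E : subcategory A) X Y Z W P (f : mor X Y) (g : mor Y Z)
    (t : mor W Z) (p : mor P Y) (q : mor P W) :
  short_exact f g -> hom_short_exact E f g -> is_pullback g t p q ->
  exists j : mor X P, short_exact j q /\ hom_short_exact E j q.
Proof.
move=> /short_exactP[kerf eg] /(hom_short_exactP E kerf) lift pb.
have [j [_ kerj]] := pullback_kernel pb kerf; exists j; split.
  by apply/short_exactP; split=> //; apply: pullback_epi pb eg.
apply/(hom_short_exactP E kerj) => e Ee y.
(* A lift of [t ∘ y] along [g], paired with [y], is a lift of [y] to the pullback. *)
have [x gx] := lift e Ee (t ∘ y).
by case: pb => _ /(_ _ _ _ gx)[w [_ qw]] _; exists w.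
Qed.

(** * Cutting, splicing and pulling back resolutions *)

Lemma resolution_tail n X K (r : resolution n.+1 X) (k : mor K (r 0)) :
  is_kernel (res_aug r) k ->
  exists r' : resolution n K, forall i, r' i = r i.+1.
Proof.
move=> kerk; have mk := kernel_mono kerk.
have [ad0 lift0] := (exact_atP _ _).1 (res_exact0 r).
have [a ka] := kernel_lift kerk ad0.
unshelve eexists (@Resolution A n K (fun i => r i.+1)
  (fun i => res_d r i.+1) a _ _ _ _) => //=.
- exact: res_left0.
- by move=> i ltin; apply: res_exact.
- have [d0d1 lift1] := (exact_atP _ _).1 (@res_exact _ _ _ r 0 isT).
  apply/exact_atP; split=> [|W h ah].
    by apply: (mono_eq0 mk); rewrite compmA ka.
  by apply: lift1; rewrite -ka -compmA ah compm0.
(* Exactness at [r 0] is applied to [k] itself: [k ∘ p] lifts through [res_d r 0], which makes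
   [a ∘ u] the epimorphism [p]. *)
- apply/exact_epiP; have [V [p [u [ep d0u]]]] := lift0 _ _ kerk.1.
  apply: (@epi_cancel _ _ _ _ _ u).
  suff -> : a ∘ u = p by [].
  by apply: mk; rewrite compmA ka.
Qed.

Lemma resolution_cons n X Y (K : A) (k : mor K Y) (a : mor Y X)
    (r : resolution n K) :
  is_kernel a k -> epimorphism a ->
  exists r' : resolution n.+1 X, r' 0 = Y /\ forall i, r' i.+1 = r i.
Proof.
move=> kerk ea; have mk := kernel_mono kerk.
pose ob i := if i is j.+1 then r j else Y.
pose d i : mor (ob i.+1) (ob i) :=
  match i with 0 => k ∘ res_aug r | j.+1 => res_d r j end.
unshelve eexists (@Resolution A n.+1 X ob d a _ _ _ _) => //=.
- exact: res_left0.
- case=> [_|i ltin] /=; last exact: res_exact.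
  have [ad0 lift0] := (exact_atP _ _).1 (res_exact0 r).
  apply/exact_atP; split=> [|W h]; first by rewrite -compmA ad0 compm0.
  by rewrite -compmA => /(mono_eq0 mk)/lift0.
- have [_ lifta] := (exact_atP _ _).1 (res_exact_aug r).
  apply/exact_atP; split=> [|W h]; first by rewrite compmA kerk.1 comp0m.
  move=> /(kernel_lift kerk)[t <-].
  have [V [p [u [ep au]]]] := lifta _ t (comp0m _ _).
  by exists V, p, u; split=> //; rewrite -!compmA au.
- exact/exact_epiP.
Qed.

Lemma resolution_pullback n (L K M : A) (b : mor L K) (r : resolution n K)
    (p : mor M L) (q : mor M (r 0)) :
  is_pullback b (res_aug r) p q ->
  exists r' : resolution n L, r' 0 = M /\ forall i, r' i.+1 = r i.+1.
Proof.
move=> pb; have [bpaq ex un] := pb.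
have [ad0 lift0] := (exact_atP _ _).1 (res_exact0 r).
(* Only degree 0 changes: the new lowest differential is the old one paired with 0 in [L]. *)
have [|d0 [pd0 qd0]] := ex _ 0 (res_d r 0); first by rewrite compm0 ad0.
pose ob i := if i is j.+1 then r j.+1 else M.
pose d i : mor (ob i.+1) (ob i) :=
  match i with 0 => d0 | j.+1 => res_d r j.+1 end.
unshelve eexists (@Resolution A n L ob d p _ _ _ _) => //=.
- exact: res_left0.
- case=> [|i] ltin /=; last exact: res_exact.
  have [d0d1 lift1] := (exact_atP _ _).1 (res_exact r ltin).
  apply/exact_atP; split=> [|W h d0h].
    apply: un; first by rewrite compmA pd0 comp0m compm0.
    by rewrite compmA qd0 d0d1 compm0.
  by apply: lift1; rewrite -qd0 -compmA d0h compm0.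
- apply/exact_atP; split=> // W h ph.
  have [|V [s [u [es d0u]]]] := lift0 _ (q ∘ h).
    by rewrite compmA -bpaq -compmA ph compm0.
  exists V, s, u; split=> //; apply: un.
    by rewrite !compmA pd0 ph !comp0m.
  by rewrite !compmA qd0 d0u.
- apply/exact_epiP; apply: (pullback_epi (pullback_sym pb)).
  by apply/exact_epiP; apply: res_exact_aug.
Qed.

Lemma has_resolution_proper_epi (E T : subcategory A) n (T' L K : A)
    (f : mor T' L) (b : mor L K) :
  closed_proper_extensions E T -> short_exact f b -> hom_short_exact E f b ->
  T T' -> has_resolution T K n -> has_resolution T L n.
Proof.
move=> clT exb homb TT' [r rT].
have [M [p [q pb]]] := pullback_exists b (res_aug r).
have [j [exj homj]] := pullback_proper exb homb pb.
have [r' [r'0 r'S]] := resolution_pullback pb.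
exists r' => -[|i] lein; last by rewrite r'S; apply: rT.
(* [M] is a proper extension of [r 0] by [T']. *)
by rewrite r'0; apply: (clT _ _ _ _ _ exj homj) => //; apply: rT.
Qed.

(** * Lengthening resolutions, and the relative dimension *)

Lemma has_resolutionS (T : subcategory A) X n :
  has_resolution T X n -> has_resolution T X n.+1.
Proof.
elim: n X => [|n IHn] X [r rT].
  have [Z TZ Z0] := sub_zero T.
  (* The zero object [r 1] is not known to lie in [T], so it is replaced by [Z], which does. *)
  pose ob i := if i is 0 then r 0 else Z.
  unshelve eexists (@Resolution A 1 X ob (fun i => 0) (res_aug r) _ _ _ _).
  - exact: Z0.
  - case=> // _; apply/exact_atP; split=> [|W h _]; first exact: comp0m.
    exists W, (idm W), 0; split; first exact: epi_id.
    by rewrite compm0 (Z0.1 _ h) comp0m.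
  (* Both exactness conditions say that the augmentation is mono. *)
  - apply/(exact_monoP _ Z0)/(exact_monoP _ (res_left0 r)).
    by rewrite -((res_left0 r).2 _ (res_d r 0)); apply: res_exact0.
  - exact: res_exact_aug.
  - by case=> [_|i _] //=; apply: rT.
have [K [k kerk]] := kernelP (res_aug r).
have [r1 r1E] := resolution_tail kerk.
have [|r2 r2T] := IHn K; first by exists r1 => i lein; rewrite r1E; apply: rT.
have [] := resolution_cons r2 kerk; first exact/exact_epiP/res_exact_aug.
move=> r3 [r30 r3S]; exists r3 => -[|i] lein; first by rewrite r30; apply: rT.
by rewrite r3S; apply: r2T.
Qed.

Lemma has_resolution_leq (T : subcategory A) X m n :
  (m <= n)%N -> has_resolution T X m -> has_resolution T X n.
Proof.
move=> /subnK <-; elim: (n - m)%N => // k IHk /IHk; exact: has_resolutionS.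
Qed.

Lemma dim_leP (T : subcategory A) X n :
  dim_le (rel_dim T X) n <-> has_resolution T X n.
Proof.
rewrite /rel_dim; case: pselect => [h|nh] /=; last first.
  by split=> // res; case: nh; exists n; apply/asboolP.
case: ex_minnP => m /asboolP resm min; split=> [lemn|resn].
  exact: has_resolution_leq resm.
by apply: min; apply/asboolP.
Qed.

Lemma generator_resolution (E T C : subcategory A) X n :
  closed_proper_extensions E T -> proper_generator E C T ->
  has_resolution T X n ->
  exists K : resolution n X, (forall i, (i < n)%N -> C (K i)) /\ T (K n).
Proof.
move=> clT [CT gen]; elim: n X => [|n IHn] X [r rT].
  by exists r; split=> //; apply: rT.
have [K [k kerk]] := kernelP (res_aug r).
have [r1 r1E] := resolution_tail kerk.
have [T' [C0 [f [g [TT' CC0 exg homg]]]]] := gen _ (rT 0 isT).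
have [L [l [b pb]]] := pullback_exists g k.
(* [b : L -> K] is again a proper epimorphism with kernel [T'], so the resolution of [K] transfers
   to [L]. *)
have [j [exj homj]] := pullback_proper exg homg pb.
have resK : has_resolution T K n by exists r1 => i lein; rewrite r1E; apply: rT.
have [r2 [r2C r2T]] := IHn L (has_resolution_proper_epi clT exj homj TT' resK).
have eag : epimorphism (res_aug r ∘ g).
  apply: epi_comp; last by case/short_exactP: exg.
  exact/exact_epiP/res_exact_aug.
(* If the composite kills [h], then [g ∘ h] factors through [k], and this factorization together
   with [h] defines a map to the pullback [L]. *)
have kerl : is_kernel (res_aug r ∘ g) l.
  have [glkb ex un] := pb.
  have mk := kernel_mono kerk.
  apply: mono_kernel => [W u v luv||W h].
  - by apply: un => //; apply: mk; rewrite !compmA -glkb -!compmA luv.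
  - by rewrite -compmA glkb compmA kerk.1 comp0m.
  - rewrite -compmA => /(kernel_lift kerk)[t kt].
    by have [w [lw _]] := ex _ h t (esym kt); exists w.
have [r3 [r30 r3S]] := resolution_cons r2 kerl eag.
exists r3; split=> [[|i] ltin|]; rewrite ?r30 ?r3S //.
exact: r2C.
Qed.

End Abelian.

End AbelianCategories.

Theorem theorem3p6 (A : abelianCategory) (E T C : subcategory A)
    (hT : preresolving E T) (hC : proper_generator E C T) (X : A) (n : nat) :
  dim_le (rel_dim T X) n <->
  exists K : resolution n X, (forall i : nat, (i < n)%N -> C (K i)) /\ T (K n).
Proof.
split=> [/dim_leP|[r [rC rT]]].
  exact: generator_resolution hT.2 hC.
apply/dim_leP; exists r => i; rewrite leq_eqVlt => /predU1P[-> //|/rC].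
exact: hC.1.
Qed.
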